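(* All automorphisms of the face lattice of the associahedron $\mathrm{Ass}_n$ are induced by symmetries of the $(n+3)$-gon. In particular, for $n\ge2$, the automorphism group of the face lattice of the associahedron $\mathrm{Ass}_n$ is isomorphic to the dihedral group of order $2n+6$.
   Context: Let $P_{n+3}$ be a convex $(n+3)$-gon. An associahedron $\mathrm{Ass}_n$ is an $n$-dimensional simple polytope whose poset of non-empty faces is isomorphic to the poset of non-crossing sets of (internal) diagonals of $P_{n+3}$, ordered by reverse inclusion; in particular its facets correspond to the diagonals. Symmetries of the $(n+3)$-gon are the dihedral symmetries (rotations and reflections) of its cyclically ordered set of vertices, i.e. the automorphisms of the boundary cycle of length $n+3$; each of them acts on the diagonals preserving crossing and non-crossing, hence on the face lattice. *)

(* Defs.v *)
From HB Require Import structures.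
From mathcomp Require Import all_boot all_order all_algebra.
From mathcomp Require Import all_fingroup all_solvable.
From mathcomp Require Import boolp classical_sets cardinality reals.
Set Implicit Arguments.
Unset Strict Implicit.
Unset Printing Implicit Defensive.
Import Order.TTheory GRing.Theory Num.Theory.
Local Open Scope classical_set_scope.
Local Open Scope card_scope.
Local Open Scope ring_scope.

Section OrderAutomorphisms.
Context {disp : Order.disp_t} (T : porderType disp).

Definition is_order_aut (f : T -> T) : Prop :=
  bijective f /\ {mono f : x y / (x <= y)%O}.

Record order_aut := OrderAut {
  order_aut_fun :> T -> T;
  _ : `[< is_order_aut order_aut_fun >]
}.

HB.instance Definition _ := [isSub for order_aut_fun].
HB.instance Definition _ := [Choice of order_aut by <:].

Implicit Types f g h : order_aut.

Lemma order_autP f : is_order_aut f.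
Proof. exact/asboolP/(valP f). Qed.

Fact order_aut1_subproof : `[< is_order_aut (@id T) >].
Proof. by apply/asboolP; split=> //; exists id. Qed.

Definition order_aut1 : order_aut := OrderAut order_aut1_subproof.

Fact order_autM_subproof f g : `[< is_order_aut (f \o g) >].
Proof.
apply/asboolP; have [[bf mf] [bg mg]] := (order_autP f, order_autP g).
by split=> [|x y /=]; [exact: bij_comp | rewrite mf mg].
Qed.

Definition order_autM f g : order_aut := OrderAut (order_autM_subproof f g).

Fact order_autV_ex f :
  {g : T -> T | cancel f g /\ cancel g f}.
Proof. by apply: cid; have [[g fK gK] _] := order_autP f; exists g. Qed.

Fact order_autV_subproof f : `[< is_order_aut (sval (order_autV_ex f)) >].
Proof.
apply/asboolP; case: (order_autV_ex f) => g /= [fK gK].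
split=> [|x y]; first by exists f.
by rewrite -[in RHS](gK x) -[in RHS](gK y) (order_autP f).2.
Qed.

Definition order_autV f : order_aut := OrderAut (order_autV_subproof f).

Fact order_autA : associative order_autM.
Proof. by move=> f g h; apply: val_inj. Qed.

Fact order_aut1g : left_id order_aut1 order_autM.
Proof. by move=> f; apply: val_inj. Qed.

Fact order_autg1 : right_id order_aut1 order_autM.
Proof. by move=> f; apply: val_inj. Qed.

Fact order_autVg : left_inverse order_aut1 order_autV order_autM.
Proof.
move=> f; apply: val_inj; apply/funext => x /=.
by case: (order_autV_ex f) => g /= [fK _]; rewrite fK.
Qed.

Fact order_autgV : right_inverse order_aut1 order_autV order_autM.
Proof.
move=> f; apply: val_inj; apply/funext => x /=.
by case: (order_autV_ex f) => g /= [_ gK]; rewrite gK.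
Qed.

HB.instance Definition _ := isGroup.Build order_aut
  order_autA order_aut1g order_autg1 order_autVg order_autgV.

End OrderAutomorphisms.

Section Polytopes.
Context {R : realType} {d : nat}.
Implicit Types A P F : set 'rV[R]_d.

Definition convex_hull A : set 'rV[R]_d :=
  [set x | exists k (a : 'I_k -> R) (v : 'I_k -> 'rV[R]_d),
     [/\ forall i, A (v i), forall i, 0 <= a i, \sum_i a i = 1
       & x = \sum_i a i *: v i]].

Definition affine_hull A : set 'rV[R]_d :=
  [set x | exists k (a : 'I_k -> R) (v : 'I_k -> 'rV[R]_d),
     [/\ forall i, A (v i), \sum_i a i = 1 & x = \sum_i a i *: v i]].

Definition has_dim A (m : nat) : Prop :=
  exists (x0 : 'rV[R]_d) (U : {vspace 'rV[R]_d}),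
    \dim U = m /\ affine_hull A = [set x0 + u | u in [set` U]].

Definition polytope P : Prop :=
  exists2 A, finite_set A & P = convex_hull A.

(* The valid inequality x *m c <= b may be trivial (c = 0), so that both set0
   and P are faces of P. *)
Definition is_face P F : Prop :=
  exists (c : 'cV[R]_d) (b : R),
    (forall x, P x -> (x *m c) 0 0 <= b) /\
    F = [set x | P x /\ (x *m c) 0 0 = b].

Record face_lattice P := Face {
  face_set :> set 'rV[R]_d;
  _ : `[< is_face P face_set >]
}.

HB.instance Definition _ P := [isSub for @face_set P].
HB.instance Definition _ P := [Choice of face_lattice P by <:].
HB.instance Definition _ P :=
  [SubChoice_isSubPOrder of face_lattice P by <: with set_display].

Definition simple_polytope (n : nat) P : Prop :=
  forall v : face_lattice P, has_dim v 0 ->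
    [set F : face_lattice P |
      (exists2 m, m.+1 = n & has_dim F m) /\ (v <= F)%O] #= `I_n.

End Polytopes.

Section Polygon.
Context {n : nat}.
(* The vertices of the (n+3)-gon, numbered in cyclic order along the
   boundary. *)
Local Notation vertex := 'I_n.+3.
Implicit Types (i j : vertex) (D E : {set vertex}) (S : {set {set vertex}}).

Definition polygon_edge i j : bool := (j == ordS i) || (i == ordS j).

Definition polygon_symmetry (s : {perm vertex}) : Prop :=
  {mono s : i j / polygon_edge i j}.

Definition polygon_diagonal D : bool :=
  [exists i, exists j, [&& i != j, ~~ polygon_edge i j & D == [set i; j]%SET]].

Definition interleaved D E : bool :=
  [exists a in D, exists b in E, exists c in D, exists e in E,
     [&& a < b, b < c & c < e]%N].

(* Two diagonals of a convex polygon meet in their interiors iff their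
   endpoints alternate along the boundary. *)
Definition crossing D E : bool := interleaved D E || interleaved E D.

Definition noncrossing S : bool :=
  [forall D in S, polygon_diagonal D] &&
  [forall D in S, forall E in S, ~~ crossing D E].

Definition polygon_act (s : {perm vertex}) S : {set {set vertex}} :=
  [set [set s i | i in D]%SET | D : {set vertex} in S]%SET.

End Polygon.

Record noncrossing_set (n : nat) := NoncrossingSet {
  diagonals :> {set {set 'I_n.+3}};
  _ : noncrossing diagonals
}.

HB.instance Definition _ n := [isSub for @diagonals n].
HB.instance Definition _ n := [Finite of noncrossing_set n by <:].

Section Associahedra.
Context {R : realType} {d : nat} (n : nat) (P : set 'rV[R]_d).

(* An isomorphism from the non-crossing sets of diagonals, ordered by reverse
   inclusion, onto the non-empty faces of P; injectivity follows from the
   antisymmetry of inclusion. *)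
Definition face_labelling (phi : noncrossing_set n -> face_lattice P) : Prop :=
  (forall S T, (phi S <= phi T)%O = (T \subset S)) /\
  (forall F : face_lattice P, (F !=set0) <-> exists S, phi S = F).

Definition associahedron : Prop :=
  [/\ polytope P, has_dim P n, simple_polytope n P
    & exists phi, face_labelling phi].

Definition induced_by (phi : noncrossing_set n -> face_lattice P)
    (s : {perm 'I_n.+3}) (f : order_aut (face_lattice P)) : Prop :=
  forall S : noncrossing_set n, exists2 T : noncrossing_set n,
    T = polygon_act s S :> {set _} & f (phi S) = phi T.

End Associahedra.

(* Main.v *)
(** An automorphism of the face lattice restricts to the non-empty faces, hence
  is a bijection of the diagonals that preserves crossing.  The ears {i-1, i+1}
  are the diagonals such that no two diagonals crossing them cross each other,
  so ears are mapped to ears.  For n >= 2 the vertex i is determined by its ear,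
  which gives a permutation s of the vertices; the ears of i and j cross iff
  i and j are adjacent, so s is a symmetry of the polygon.  A diagonal is the
  set of vertices whose ears it crosses, so it is mapped to its image under s.
  Conversely every symmetry is a product of rotations and a reflection, which
  preserve crossing; for n >= 2 distinct symmetries act differently on ears. *)

Require Import Defs.
From HB Require Import structures.
From mathcomp Require Import all_boot all_order all_algebra.
From mathcomp Require Import all_fingroup all_solvable.
From mathcomp Require Import boolp classical_sets cardinality reals.
From mathcomp Require Import zify.
Set Implicit Arguments.
Unset Strict Implicit.
Unset Printing Implicit Defensive.

(** * Diagonals, their crossings and ears *)

Section Diagonals.
Variable n : nat.
Local Notation vertex := 'I_n.+3.
Implicit Types (i j : vertex) (D E F : {set vertex}).

Lemma eq_ordE i j : (i == j) = (i == j :> nat).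
Proof. by []. Qed.

Lemma val_ordS i : ordS i = (if i < n.+2 then i.+1 else 0) :> nat.
Proof.
rewrite /=; case: ltnP => [lt_i|le_i]; first by rewrite modn_small.
by have -> : i = n.+2 :> nat; [have := ltn_ord i; lia | rewrite modnn].
Qed.

Lemma val_ord_pred i : ord_pred i = (if 0 < i then i.-1 else n.+2) :> nat.
Proof.
rewrite /=; case: i => -[|i] lt_i /=; first by rewrite modn_small.
by rewrite modnDr modn_small //; lia.
Qed.

(** Sorting the endpoints with [minn] and [maxn] turns alternation along the boundary into linear
    arithmetic, which [lia] can decide. *)
Lemma crossing_set2 i j k l :
  crossing [set i; j]%SET [set k; l]%SET =
    (minn i j < minn k l < maxn i j) && (maxn i j < maxn k l) ||
    (minn k l < minn i j < maxn k l) && (maxn k l < maxn i j).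
Proof.
have interleaved_set2 a b c e :
    interleaved [set a; b]%SET [set c; e]%SET =
    [|| [&& a < c, c < b & b < e], [&& a < e, e < b & b < c],
        [&& b < c, c < a & a < e] | [&& b < e, e < a & a < c]]
      :> bool.
  apply/idP/idP.
    case/exists_inP => x /set2P xab /exists_inP[y /set2P yce].
    case/exists_inP => z /set2P zab /exists_inP[w /set2P wce].
    by case: xab => ->; case: yce => ->; case: zab => ->; case: wce => ->; lia.
  have ex x y z w : x \in [set a; b]%SET -> y \in [set c; e]%SET ->
      z \in [set a; b]%SET -> w \in [set c; e]%SET ->
      [&& x < y, y < z & z < w] -> interleaved [set a; b]%SET [set c; e]%SET.
    move=> xab yce zab wce lt_xyzw; apply/exists_inP; exists x => //.
    apply/exists_inP; exists y => //; apply/exists_inP; exists z => //.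
    by apply/exists_inP; exists w.
  by case/or4P => /ex; apply; rewrite ?set21 ?set22.
rewrite /crossing !interleaved_set2 /minn /maxn.
by case: (ltnP i j) => ?; case: (ltnP k l) => ?; apply/idP/idP; lia.
Qed.

Lemma crossing_lt i j (k l : vertex) : i < j -> k < l ->
  crossing [set i; j]%SET [set k; l]%SET =
    [&& i < k, k < j & j < l] || [&& k < i, i < l & l < j].
Proof.
move=> lt_ij lt_kl; rewrite crossing_set2.
rewrite (minn_idPl (ltnW lt_ij)) (maxn_idPr (ltnW lt_ij)).
by rewrite (minn_idPl (ltnW lt_kl)) (maxn_idPr (ltnW lt_kl)) !andbA.
Qed.

Lemma polygon_edgeE i j :
  polygon_edge i j =
    [|| i.+1 == j, j.+1 == i, (i == 0 :> nat) && (j == n.+2 :> nat)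
      | (j == 0 :> nat) && (i == n.+2 :> nat)].
Proof.
rewrite /polygon_edge !eq_ordE !val_ordS /=.
by have := ltn_ord i; have := ltn_ord j; do 2 case: ifP; lia.
Qed.

Lemma polygon_edge_sym i j : polygon_edge i j = polygon_edge j i.
Proof. by rewrite /polygon_edge orbC. Qed.

(** The first inequality excludes the edges {i, i+1}; since j is at most n+2, the second excludes
    only the edge {0, n+2}. *)
Lemma polygon_diagonalP D :
  reflect (exists i j, [/\ D = [set i; j]%SET, i.+1 < j & j < i + n.+2])
    (polygon_diagonal D).
Proof.
apply: (iffP idP) => [/existsP[i /existsP[j]]|[i [j [-> lt_ij lt_ji]]]].
  rewrite polygon_edgeE eq_ordE /= => /and3P[neq_ij nedge_ij /eqP ->].
  have [lt_i lt_j] := (ltn_ord i, ltn_ord j).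
  have [lt_ij|le_ji] := ltnP i j; first by exists i, j; split=> //; lia.
  by exists j, i; rewrite finset.setUC; split=> //; lia.
apply/existsP; exists i; apply/existsP; exists j.
by rewrite eqxx polygon_edgeE eq_ordE /=; lia.
Qed.

Lemma crossing_irr D : polygon_diagonal D -> ~~ crossing D D.
Proof.
by case/polygon_diagonalP => i [j [-> ? ?]]; rewrite crossing_set2; lia.
Qed.

Lemma crossingC D E : crossing D E = crossing E D.
Proof. exact: orbC. Qed.

Definition ear i : {set vertex} := [set ord_pred i; ordS i]%SET.

Lemma in_ear i j : (j \in ear i) = polygon_edge i j.
Proof.
rewrite /ear in_set2 !eq_ordE val_ord_pred val_ordS polygon_edgeE.
by have := ltn_ord i; have := ltn_ord j; do 2 case: ifP; lia.
Qed.

Lemma polygon_diagonal_ear i : 0 < n -> polygon_diagonal (ear i).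
Proof.
move=> n_gt0; apply/existsP; exists (ord_pred i); apply/existsP; exists (ordS i).
rewrite eqxx polygon_edgeE eq_ordE val_ordS val_ord_pred /=.
by have := ltn_ord i; do 2 case: ifP; lia.
Qed.

(** One side of the ear contains the single vertex i, so a diagonal crossing it ends in i.
    Conversely, the other end of a diagonal at i is not adjacent to i, hence lies beyond the ear. *)
Lemma crossing_ear i D : polygon_diagonal D -> crossing (ear i) D = (i \in D).
Proof.
case/polygon_diagonalP => a [b [-> lt_ab lt_ba]].
rewrite crossing_set2 val_ordS val_ord_pred in_set2 !eq_ordE /=.
by have := ltn_ord i; have := ltn_ord b; do 2 case: ifP; lia.
Qed.

Lemma crossing_ears i j : 0 < n -> crossing (ear i) (ear j) = polygon_edge i j.
Proof.
by move=> n_gt0; rewrite crossing_ear ?polygon_diagonal_ear// in_ear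
  polygon_edge_sym.
Qed.

(** With at least five vertices, i is the only common neighbour of i-1 and i+1. In a quadrilateral,
    opposite vertices share their ear. *)
Lemma ear_inj : 1 < n -> injective ear.
Proof.
move=> n_gt1 i j eq_ear.
have := in_ear j (ordS i); have := in_ear j (ord_pred i).
rewrite -eq_ear set21 set22 !polygon_edgeE val_ordS val_ord_pred => ed1 ed2.
apply: val_inj => /=; move: ed1 ed2.
by have := ltn_ord i; have := ltn_ord j; do 2 case: ifP; lia.
Qed.

(* Two diagonals crossing an ear at i both end in i.  If {i, j} is not an ear,
   then {i+1, j+1} and {i-1, j-1} cross it and each other. *)
Lemma ear_char D : polygon_diagonal D ->
  (exists i, D = ear i) <->
  (forall E F, polygon_diagonal E -> polygon_diagonal F ->
     crossing D E -> crossing D F -> ~~ crossing E F).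
Proof.
move=> diagD; split=> [[i ->] E F diagE diagF|].
  rewrite !crossing_ear//.
  case/polygon_diagonalP: diagE => a [b [-> ? ?]].
  case/polygon_diagonalP: diagF => c [e [-> ? ?]].
  by rewrite !in_set2 crossing_set2 !eq_ordE /=; lia.
case/polygon_diagonalP: diagD => a [b [-> lt_ab lt_ba]] noncross.
have [lt_a lt_b] := (ltn_ord a, ltn_ord b).
have [eq_ab|neq_ab] := eqVneq (a.+2) (b : nat).
  exists (ordS a); apply/finset.setP => x; rewrite in_ear in_set2 polygon_edgeE.
  by rewrite !eq_ordE val_ordS /=; have := ltn_ord x; case: ifP; lia.
(* Here a is b+2 modulo n+3, so the ear is the one at b+1. *)
have [eq_ba|neq_ba] := eqVneq (b : nat) (a + n.+1).
  exists (ordS b); apply/finset.setP => x; rewrite in_ear in_set2 polygon_edgeE.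
  by rewrite !eq_ordE val_ordS /=; have := ltn_ord x; case: ifP; lia.
pose E := [set ordS a; ordS b]%SET; pose F := [set ord_pred a; ord_pred b]%SET.
suff: [/\ polygon_diagonal E, polygon_diagonal F, crossing [set a; b]%SET E,
          crossing [set a; b]%SET F & crossing E F].
  by case=> dE dF cE cF cEF; have := noncross E F dE dF cE cF; rewrite cEF.
rewrite !crossing_set2 !val_ordS !val_ord_pred; split.
- apply/existsP; exists (ordS a); apply/existsP; exists (ordS b).
  rewrite eqxx eq_ordE polygon_edgeE !val_ordS.
  by do 2 case: ifP; lia.
- apply/existsP; exists (ord_pred a); apply/existsP; exists (ord_pred b).
  rewrite eqxx eq_ordE polygon_edgeE !val_ord_pred.
  by do 2 case: ifP; lia.
- by do 2 case: ifP; lia.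
- by do 2 case: ifP; lia.
- by do 4 case: ifP; lia.
Qed.
End Diagonals.

(** * Symmetries of the polygon and their action on diagonals *)

Section Symmetries.
Variable n : nat.
Local Notation vertex := 'I_n.+3.
Implicit Types (i j : vertex) (D E F : {set vertex}) (s t : {perm vertex}).
Local Open Scope group_scope.

Definition rotation : {perm vertex} := perm (@ordS_inj n.+3).
Definition reflection : {perm vertex} := perm (@rev_ord_inj n.+3).

Lemma polygon_symmetry1 : polygon_symmetry (1 : {perm vertex}).
Proof. by move=> i j; rewrite !perm1. Qed.

Lemma polygon_symmetryM s t :
  polygon_symmetry s -> polygon_symmetry t -> polygon_symmetry (s * t).
Proof. by move=> sym_s sym_t i j; rewrite !permM sym_t sym_s. Qed.

Lemma polygon_symmetryV s : polygon_symmetry s -> polygon_symmetry s^-1.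
Proof. by move=> sym_s i j; rewrite -sym_s !permKV. Qed.

Lemma polygon_symmetryX s k : polygon_symmetry s -> polygon_symmetry (s ^+ k).
Proof.
move=> sym_s; elim: k => [|k IHk]; first exact: polygon_symmetry1.
by rewrite expgS; apply: polygon_symmetryM.
Qed.

Lemma polygon_symmetry_rotation : polygon_symmetry rotation.
Proof.
by move=> i j; rewrite !permE /polygon_edge !(inj_eq (@ordS_inj _)).
Qed.

Lemma polygon_symmetry_reflection : polygon_symmetry reflection.
Proof.
move=> i j; rewrite !permE !polygon_edgeE /=.
by have := ltn_ord i; have := ltn_ord j; lia.
Qed.

Lemma rotationX k i : (rotation ^+ k) i = (i + k) %% n.+3 :> nat.
Proof.
rewrite permX; elim: k => [|k IHk]; first by rewrite addn0 modn_small.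
by rewrite iterS permE /= IHk -addn1 modnDml addn1 addnS.
Qed.

Lemma reflectionK : reflection * reflection = 1.
Proof. by apply/permP => i; rewrite permM !permE rev_ordK. Qed.

Lemma rotationXn3 : rotation ^+ n.+3 = 1.
Proof.
apply/permP => i; apply: ord_inj.
by rewrite perm1 /= rotationX modnDr modn_small.
Qed.

Lemma val_rev_ord i : rev_ord i = n.+2 - i :> nat.
Proof. by rewrite /= subSS. Qed.

Lemma rotation_reflection : rotation * reflection * rotation = reflection.
Proof.
apply/permP => i; apply: ord_inj; rewrite !permM !permE.
rewrite val_ordS !val_rev_ord val_ordS.
by have := ltn_ord i; do 2 case: ifP; lia.
Qed.

(** Fixed vertices propagate along the boundary: once k and k+1 are fixed, the image of k+2 is a
    neighbour of k+1 other than k, so it is k+2. *)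
Lemma polygon_symmetry_fix01 s : polygon_symmetry s ->
  s ord0 = ord0 -> s (ordS ord0) = ordS ord0 -> s = 1.
Proof.
move=> sym_s s0 s1.
suff fix_s k : k < n.+2 -> forall i, i <= k.+1 -> s i = i.
  apply/permP => i; rewrite perm1; apply: (fix_s n.+1) => //.
  by rewrite -ltnS.
elim: k => [_ i|k IHk lt_k i]; rewrite leq_eqVlt ltnS.
  case/orP => [/eqP i1|i0].
    by have -> : i = ordS ord0 by apply: ord_inj; rewrite val_ordS.
  by have -> : i = ord0 by apply: ord_inj => /=; lia.
case/orP => [/eqP ik|]; last by apply: IHk; lia.
pose j : vertex := inord k.+1; pose h : vertex := inord k.
have jE : j = k.+1 :> nat by rewrite inordK; lia.
have hE : h = k :> nat by rewrite inordK; lia.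
have sj : s j = j by apply: IHk; lia.
have sh : s h = h by apply: IHk; lia.
have neq_ih : s i != h.
  by rewrite -sh (inj_eq (@perm_inj _ s)) eq_ordE; lia.
have : polygon_edge (s i) j by rewrite -sj sym_s polygon_edgeE; lia.
rewrite polygon_edgeE; rewrite eq_ordE in neq_ih; have := ltn_ord i.
by move=> lt_i /or4P[] edge_ij; apply: ord_inj; lia.
Qed.

Lemma polygon_symmetry_decomp s : polygon_symmetry s ->
  exists b k, s = reflection ^+ b * rotation ^+ k.
Proof.
move=> sym_s; pose k : nat := s ord0; have lt_k : k < n.+3 by exact: ltn_ord.
(* Permutations compose left to right, so [u] applies [s] and then rotates [s ord0] back to 0. A
   neighbour of 0 must then be the image of 1. *)
pose u := s * rotation ^+ (n.+3 - k).
have sE : s = u * rotation ^+ k.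
  by rewrite /u -mulgA -expgD subnK ?rotationXn3 ?mulg1 // ltnW.
have sym_u : polygon_symmetry u.
  by apply/polygon_symmetryM/polygon_symmetryX/polygon_symmetry_rotation.
have u0 : u ord0 = ord0.
  by apply: ord_inj; rewrite permM /= rotationX subnKC ?modnn // ltnW.
clearbody u.
have := sym_u ord0 (ordS ord0); rewrite u0 !polygon_edgeE val_ordS /=.
have lt_u := ltn_ord (u (ordS ord0)).
have [u1 _|u1 u2] := eqVneq (u (ordS ord0)) (ordS ord0).
  exists 0, k; rewrite [LHS]sE expg0; congr (_ * _).
  exact: polygon_symmetry_fix01.
(* Reflection followed by one rotation is negation modulo n+3: it fixes 0 and sends n+2, the image
   of 1 under [u], back to 1. *)
pose v := u * reflection * rotation.
have sym_v : polygon_symmetry v.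
  apply: polygon_symmetryM polygon_symmetry_rotation.
  exact: polygon_symmetryM polygon_symmetry_reflection.
have v1 : v = 1.
  apply: polygon_symmetry_fix01 => //; apply: ord_inj.
    by rewrite /v !permM u0 !permE val_ordS val_rev_ord /=; case: ifP; lia.
  move: u1 u2; rewrite /v !permM eq_ordE !permE !val_ordS val_rev_ord.
  by rewrite /=; case: ifP; lia.
exists 1%N, k.+1; rewrite expg1 [LHS]sE expgS mulgA; congr (_ * _).
apply: (mulIg (reflection * rotation)); rewrite mulgA -/v v1 -mulgA.
by rewrite [rotation * _]mulgA rotation_reflection reflectionK.
Qed.

Lemma imset_ear s i : polygon_symmetry s -> [set s j | j in ear i]%SET = ear (s i).
Proof.
move=> sym_s; apply/finset.setP => j; rewrite -[j](permKV s).
by rewrite (mem_imset _ _ (@perm_inj _ s)) !in_ear sym_s.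
Qed.

Lemma polygon_diagonal_imset s D : polygon_symmetry s ->
  polygon_diagonal D -> polygon_diagonal [set s i | i in D]%SET.
Proof.
move=> sym_s /existsP[i /existsP[j /and3P[neq_ij nedge_ij /eqP ->]]].
apply/existsP; exists (s i); apply/existsP; exists (s j).
by rewrite (inj_eq (@perm_inj _ s)) neq_ij sym_s nedge_ij imsetU1 imset_set1 /=.
Qed.

Lemma crossing_imset s D E : polygon_symmetry s ->
  polygon_diagonal D -> polygon_diagonal E ->
  crossing [set s i | i in D]%SET [set s i | i in E]%SET = crossing D E.
Proof.
(* [Q] is closed under products, so it need only be checked on the generators. It includes being a
   symmetry because the second factor of a product is applied to images, which must again be
   diagonals. *)
pose Q t := polygon_symmetry t /\ forall D E, polygon_diagonal D ->
  polygon_diagonal E ->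
  crossing [set t i | i in D]%SET [set t i | i in E]%SET = crossing D E.
have imset_id (F : {set vertex}) : [set (1 : {perm vertex}) i | i in F]%SET = F.
  by rewrite -[RHS]imset_id; apply: eq_imset => i; rewrite perm1.
have Q1 : Q 1.
  by split=> [|A B dA dB]; rewrite ?imset_id//; apply: polygon_symmetry1.
have QM t u : Q t -> Q u -> Q (t * u).
  move=> [sym_t crt] [sym_u cru]; split; first exact: polygon_symmetryM.
  have imset_comp (F : {set vertex}) : [set (t * u) i | i in F]%SET =
      [set u i | i in [set t i | i in F]]%SET.
    by rewrite -imset_comp; apply: eq_imset => i; rewrite permM.
  move=> A B dA dB; rewrite !imset_comp cru ?crt //;
  exact: polygon_diagonal_imset.
have QX t k : Q t -> Q (t ^+ k).
  by move=> Qt; elim: k => [|k IHk]; [exact: Q1 | rewrite expgS; apply: QM].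
have QE t : polygon_symmetry t -> (forall i j (k l : vertex), i < j -> k < l ->
    crossing [set t i; t j]%SET [set t k; t l]%SET =
    crossing [set i; j]%SET [set k; l]%SET) -> Q t.
  move=> sym_t crt; split=> // A B.
  case/polygon_diagonalP=> i [j [-> /ltnW lt_ij _]].
  case/polygon_diagonalP=> k [l [-> /ltnW lt_kl _]].
  by rewrite !imsetU1 !imset_set1 crt.
have Qrot : Q rotation.
  apply: QE polygon_symmetry_rotation _ => i j k l lt_ij lt_kl.
  have [lt_j lt_l] := (ltn_ord j, ltn_ord l).
  have jE : ordS j = (if j < n.+2 then j.+1 else 0) :> nat by exact: val_ordS.
  have lE : ordS l = (if l < n.+2 then l.+1 else 0) :> nat by exact: val_ordS.
  have iE : ordS i = i.+1 :> nat by rewrite val_ordS; case: ifP; lia.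
  have kE : ordS k = k.+1 :> nat by rewrite val_ordS; case: ifP; lia.
  (* Rotation preserves the order of the endpoints unless the larger one is n+2, which wraps to 0;
     then the two endpoints are swapped. *)
  rewrite !permE; case: ltnP jE => [lt_jn|le_nj] jE;
    case: ltnP lE => [lt_ln|le_nl] lE.
  - by rewrite !crossing_lt ?iE ?jE ?kE ?lE.
  - rewrite [X in crossing _ X]finset.setUC !crossing_lt ?iE ?jE ?kE ?lE//.
    by apply/idP/idP; lia.
  - rewrite [X in crossing X _]finset.setUC !crossing_lt ?iE ?jE ?kE ?lE//.
    by apply/idP/idP; lia.
  - rewrite finset.setUC [X in crossing _ X]finset.setUC.
    by rewrite !crossing_lt ?iE ?jE ?kE ?lE//; apply/idP/idP; lia.
have Qref : Q reflection.
  apply: QE polygon_symmetry_reflection _ => i j k l lt_ij lt_kl.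
  have [lt_j lt_l] := (ltn_ord j, ltn_ord l).
  have rev_lt (a b : vertex) : (rev_ord a < rev_ord b) = (b < a).
    by have := ltn_ord a; rewrite !val_rev_ord; lia.
  rewrite !permE finset.setUC [X in crossing _ X]finset.setUC.
  by rewrite !crossing_lt ?rev_lt//; apply/idP/idP; lia.
move=> sym_s; have [b [k ->]] := polygon_symmetry_decomp sym_s.
exact: (QM _ _ (QX _ b Qref) (QX _ k Qrot)).2.
Qed.

End Symmetries.

(** * Crossing-preserving bijections of the diagonals, for polygons with at least five vertices *)

Section DiagonalBijections.
Variable n : nat.
Local Notation vertex := 'I_n.+3.
Implicit Types (i : vertex) (D E F : {set vertex}).

Variable g : {set vertex} -> {set vertex}.
Hypothesis g_diag : forall D, polygon_diagonal D -> polygon_diagonal (g D).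
Hypothesis g_inj : forall D E, polygon_diagonal D -> polygon_diagonal E ->
  g D = g E -> D = E.
Hypothesis g_onto : forall E, polygon_diagonal E ->
  exists2 D, polygon_diagonal D & g D = E.
Hypothesis g_cross : forall D E, polygon_diagonal D -> polygon_diagonal E ->
  crossing (g D) (g E) = crossing D E.

(** The characterisation of ears speaks only of crossings between diagonals, so it can be pulled
    back along [g] by [g_onto] and [g_cross]. *)
Lemma ear_bijection i : 0 < n -> exists j, g (ear i) = ear j.
Proof.
move=> n_gt0; have dear := polygon_diagonal_ear i n_gt0.
apply/(ear_char (g_diag dear)) => E F.
move=> /g_onto[{}E dE <-] /g_onto[{}F dF <-]; rewrite !g_cross//.
by apply: (ear_char dear).1 => //; exists i.
Qed.

Lemma diagonal_bijection_large : 1 < n ->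
  exists2 s, polygon_symmetry s &
    forall D, polygon_diagonal D -> g D = [set s i | i in D]%SET.
Proof.
move=> n_gt1; have n_gt0 := ltnW n_gt1.
have dear i := polygon_diagonal_ear i n_gt0.
have [u gu] := choice (fun i => ear_bijection i n_gt0).
have u_inj : injective u.
  move=> i j eq_u; apply: (ear_inj n_gt1); apply: g_inj => //.
  by rewrite !gu eq_u.
pose s := perm u_inj; have gs i : g (ear i) = ear (s i) by rewrite permE.
exists s => [i j|D dD]; first by rewrite -!crossing_ears// -!gs g_cross.
(* Writing the vertex as a value of [s] makes its ear the image under [g] of an ear, so that
   [g_cross] applies. *)
apply/finset.setP => i; rewrite -[i](permKV s).
rewrite (mem_imset _ _ (@perm_inj _ s)) -crossing_ear ?g_diag//.
by rewrite -gs g_cross// crossing_ear.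
Qed.

End DiagonalBijections.

(** * The quadrilateral, whose ears do not determine their vertices *)

Section Quadrilateral.

Lemma quadrilateral_diagonal (D : {set 'I_4}) : polygon_diagonal D ->
  D = ear ord0 \/ D = ear (ordS ord0).
Proof.
case/polygon_diagonalP => i [j [-> lt_ij lt_ji]]; have lt_j := ltn_ord j.
have [i0|i1] : i = 0 :> nat \/ i = 1 :> nat by lia.
  right; congr [set _; _]%SET; apply: ord_inj => /=; rewrite ?i0//; lia.
left; rewrite finset.setUC; congr [set _; _]%SET; apply: ord_inj => /=;
  rewrite ?i1//; lia.
Qed.

(** There are only two diagonals: they are either both fixed, as by the identity, or exchanged, as
    by one rotation step. *)
Lemma quadrilateral_bijection (g : {set 'I_4} -> {set 'I_4}) :
  (forall D, polygon_diagonal D -> polygon_diagonal (g D)) ->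
  (forall D E, polygon_diagonal D -> polygon_diagonal E -> g D = g E -> D = E) ->
  exists2 s : {perm 'I_4}, polygon_symmetry s &
    forall D, polygon_diagonal D -> g D = [set s i | i in D]%SET.
Proof.
move=> g_diag g_inj.
have d0 : polygon_diagonal (ear (ord0 : 'I_4)) by apply: polygon_diagonal_ear.
have d1 : polygon_diagonal (ear (ordS ord0 : 'I_4)) by apply: polygon_diagonal_ear.
have g_id : g (ear ord0) = ear ord0 -> g (ear (ordS ord0)) = ear (ordS ord0) ->
    exists2 s : {perm 'I_4}, polygon_symmetry s &
    forall D, polygon_diagonal D -> g D = [set s i | i in D]%SET.
  move=> g0 g1; exists 1%g; first exact: polygon_symmetry1.
  move=> D dD; rewrite (_ : imset _ _ = D); last first.
    by rewrite -[RHS]imset_id; apply: eq_imset => i; rewrite perm1.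
  by case: (quadrilateral_diagonal dD) => ->.
case: (quadrilateral_diagonal (g_diag _ d0)) => g0;
  case: (quadrilateral_diagonal (g_diag _ d1)) => g1.
(* If both diagonals had the same image, injectivity would identify them, and [g_id] would still
   apply. *)
- by apply: g_id => //; rewrite g1; apply: g_inj; rewrite ?g0.
- exact: g_id.
- exists (rotation 1); first exact: polygon_symmetry_rotation.
  move=> D /quadrilateral_diagonal[] ->;
    rewrite imset_ear ?permE; try exact: polygon_symmetry_rotation;
    rewrite ?g0 ?g1 //.
  by rewrite /ear finset.setUC; congr [set _; _]%SET; apply: ord_inj.
- by apply: g_id => //; rewrite g0; apply: g_inj; rewrite ?g1.
Qed.

End Quadrilateral.

Lemma diagonal_bijection n (g : {set 'I_n.+3} -> {set 'I_n.+3}) :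
  (forall D, polygon_diagonal D -> polygon_diagonal (g D)) ->
  (forall D E, polygon_diagonal D -> polygon_diagonal E -> g D = g E -> D = E) ->
  (forall E, polygon_diagonal E -> exists2 D, polygon_diagonal D & g D = E) ->
  (forall D E, polygon_diagonal D -> polygon_diagonal E ->
     crossing (g D) (g E) = crossing D E) ->
  exists2 s : {perm 'I_n.+3}, polygon_symmetry s &
    forall D, polygon_diagonal D -> g D = [set s i | i in D]%SET.
Proof.
case: n g => [|[|n]] g g_diag g_inj g_onto g_cross.
(* A triangle has no diagonals, so the identity works vacuously. *)
- exists 1%g => [|D /polygon_diagonalP[i [j [_ ? ?]]]]; last lia.
  exact: polygon_symmetry1.
- exact: quadrilateral_bijection.
- exact: diagonal_bijection_large.
Qed.

(** * The complex of non-crossing sets and its automorphisms *)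

Section Complex.
Variable n : nat.
Local Notation vertex := 'I_n.+3.
Implicit Types (D E : {set vertex}) (S T : noncrossing_set n).

Lemma noncrossing_diagonal S D : D \in diagonals S -> polygon_diagonal D.
Proof. by move=> DS; have /andP[/forall_inP/(_ D DS)] := valP S. Qed.

Lemma noncrossing_crossing S D E :
  D \in diagonals S -> E \in diagonals S -> ~~ crossing D E.
Proof.
by move=> DS ES; have /andP[_ /forall_inP/(_ D DS)/forall_inP/(_ E ES)] := valP S.
Qed.

Lemma noncrossing_set2 D E : polygon_diagonal D -> polygon_diagonal E ->
  ~~ crossing D E -> noncrossing [set D; E]%SET.
Proof.
move=> dD dE ncDE; apply/andP; split.
  by apply/forall_inP => F /set2P[] ->.
apply/forall_inP => F /set2P[] ->; apply/forall_inP => G /set2P[] -> //;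
  by rewrite ?crossing_irr// crossingC.
Qed.

Lemma noncrossing0 : noncrossing (finset.set0 : {set {set vertex}}).
Proof. by apply/andP; split; apply/forall_inP => D; rewrite finset.in_set0. Qed.

Lemma noncrossing1 D : polygon_diagonal D -> noncrossing [set D]%SET.
Proof.
by move=> dD; rewrite -(finset.setUid [set D]%SET) noncrossing_set2 ?crossing_irr.
Qed.

(** The singletons are the atoms of the complex, so [h] permutes the diagonals; two diagonals do not
    cross exactly when they lie in a common non-crossing set, so this permutation preserves
    crossing. *)
Lemma noncrossing_set_aut (h : noncrossing_set n -> noncrossing_set n) :
  {mono h : S T / S \subset T} ->
  exists2 s : {perm vertex}, polygon_symmetry s &
    forall S, h S = polygon_act s S :> {set _}.
Proof.
move=> h_mono.
have h_inj : injective h.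
  move=> S T eq_h; apply: val_inj; apply/eqP; rewrite finset.eqEsubset.
  by rewrite -h_mono eq_h subxx /= -h_mono eq_h subxx.
have h_onto T : exists S, h S = T by exists (invF h_inj T); rewrite f_invF.
pose nc0 := NoncrossingSet noncrossing0.
pose nc1 D (dD : polygon_diagonal D) := NoncrossingSet (noncrossing1 dD).
have h0 : h nc0 = nc0.
  have [T hT] := h_onto nc0; apply: val_inj; apply/eqP.
  by rewrite -finset.subset0 -[finset.set0]/(val nc0) -{2}hT h_mono finset.sub0set.
(* [E] is any element of the image of {D}. The preimage of {E} is a non-empty subset of {D}, hence
   {D} itself. The premise sits inside the existential so that [choice] yields a total function. *)
have g_ex D : exists E, polygon_diagonal D -> polygon_diagonal E /\
    forall S, (E \in diagonals (h S)) = (D \in diagonals S).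
  have [dD|] := boolP (polygon_diagonal D); last by exists D.
  have : ~~ (h (nc1 _ dD) \subset nc0).
    by rewrite -h0 h_mono finset.subset0 -finset.cards_eq0 cards1.
  rewrite finset.subset0 => /set0Pn[E hE]; exists E => _.
  have dE := noncrossing_diagonal hE; split=> // S.
  have [T hT] := h_onto (nc1 _ dE).
  have subT : T \subset nc1 _ dD by rewrite -h_mono hT finset.sub1set.
  have TD : val T = [set D]%SET.
    apply/eqP; move: subT; rewrite finset.subset1 => /orP[//|/eqP T0].
    have TE : T = nc0 by exact: val_inj.
    have := set11 E; have := congr1 val hT; rewrite TE h0 /= => <-.
    by rewrite finset.in_set0.
  rewrite -finset.sub1set -[[set E]%SET]/(val (nc1 _ dE)) -hT h_mono TD.
  by rewrite finset.sub1set.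
have [g gP] := choice g_ex.
have g_onto E : polygon_diagonal E -> exists2 D, polygon_diagonal D & g D = E.
  move=> dE; have [T hT] := h_onto (nc1 _ dE).
  have : ~~ (T \subset nc0).
    by rewrite -h_mono hT h0 finset.subset0 -finset.cards_eq0 cards1.
  rewrite finset.subset0 => /set0Pn[D DT]; have dD := noncrossing_diagonal DT.
  by exists D => //; apply/set1P; rewrite -((gP D dD).2 T) hT in DT.
have g_inj D E : polygon_diagonal D -> polygon_diagonal E -> g D = g E -> D = E.
  move=> dD dE eq_g; apply/set1P; rewrite -[[set E]%SET]/(val (nc1 _ dE)).
  by rewrite -((gP D dD).2) eq_g ((gP E dE).2) set11.
have g_cross D E : polygon_diagonal D -> polygon_diagonal E ->
    crossing (g D) (g E) = crossing D E.
  move=> dD dE; have [[dgD gD] [dgE gE]] := (gP D dD, gP E dE).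
  apply: negb_inj; apply/idP/idP => nc.
    have [S hS] := h_onto (NoncrossingSet (noncrossing_set2 dgD dgE nc)).
    by apply: (@noncrossing_crossing S); rewrite -?gD -?gE hS ?set21 ?set22.
  pose S := NoncrossingSet (noncrossing_set2 dD dE nc).
  by apply: (@noncrossing_crossing (h S)); rewrite ?gD ?gE ?set21 ?set22.
have [s sym_s gs] :=
  diagonal_bijection (fun D dD => (gP D dD).1) g_inj g_onto g_cross.
exists s => // S; apply/finset.setP => E; apply/idP/imsetP => [EhS|[D DS ->]].
  have [D dD gDE] := g_onto E (noncrossing_diagonal EhS).
  by exists D; rewrite -?gs// -((gP D dD).2) gDE.
have dD := noncrossing_diagonal DS.
by rewrite -gs// (gP D dD).2.
Qed.

Lemma polygon_act_noncrossing (s : {perm vertex}) S :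
  polygon_symmetry s -> noncrossing (polygon_act s S).
Proof.
move=> sym_s; apply/andP; split.
  apply/forall_inP => _ /imsetP[D DS ->]; apply: polygon_diagonal_imset => //.
  exact: noncrossing_diagonal DS.
apply/forall_inP => _ /imsetP[D DS ->]; apply/forall_inP => _ /imsetP[E ES ->].
rewrite crossing_imset ?(noncrossing_diagonal DS) ?(noncrossing_diagonal ES)//.
exact: noncrossing_crossing ES.
Qed.

Lemma polygon_act1 (S : {set {set vertex}}) : polygon_act 1%g S = S.
Proof.
rewrite -[RHS]imset_id; apply: eq_imset => D.
by rewrite -[RHS]imset_id; apply: eq_imset => i; rewrite perm1.
Qed.

Lemma polygon_actM (s t : {perm vertex}) (S : {set {set vertex}}) :
  polygon_act (s * t)%g S = polygon_act t (polygon_act s S).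
Proof.
rewrite /polygon_act -imset_comp; apply: eq_imset => D /=.
by rewrite -imset_comp; apply: eq_imset => i; rewrite permM.
Qed.

(** It suffices to act on the sets consisting of a single ear, since ears determine their
    vertices. *)
Lemma polygon_act_faithful (s t : {perm vertex}) : 1 < n ->
  polygon_symmetry s -> polygon_symmetry t ->
  (forall S, polygon_act s S = polygon_act t S) -> s = t.
Proof.
move=> n_gt1 sym_s sym_t eq_act; apply/permP => i; apply: ear_inj => //.
have dear := polygon_diagonal_ear i (ltnW n_gt1).
have := eq_act (NoncrossingSet (noncrossing1 dear)).
by rewrite /polygon_act /= !imset_set1 !imset_ear// => /set1_inj.
Qed.

End Complex.

(** * The symmetries of the polygon form a dihedral group *)

Section DihedralGroup.
Variable n : nat.
Local Notation vertex := 'I_n.+3.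
Local Open Scope group_scope.

Definition polygon_symmetry_group : {group {perm vertex}} :=
  <<[set rotation n; reflection n]%SET>>%G.

Lemma mem_polygon_symmetry_group (s : {perm vertex}) :
  s \in polygon_symmetry_group <-> polygon_symmetry s.
Proof.
split=> [/gen_prodgP[k [c inc ->]]|/polygon_symmetry_decomp[b [k ->]]].
  elim/big_ind: _ => [|s1 s2|i _].
  - exact: polygon_symmetry1.
  - exact: polygon_symmetryM.
  - have /set2P[->|->] := inc i; first exact: polygon_symmetry_rotation.
    exact: polygon_symmetry_reflection.
by rewrite groupM// groupX// mem_gen ?set21 ?set22.
Qed.

(** The rotations form a subgroup of order at least n+3 that misses the reflection, so its index is
    at least 2. *)
Lemma card_polygon_symmetry_group : n.+3.*2 <= #|polygon_symmetry_group|.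
Proof.
pose r := rotation n.
have rG : <[r]> \subset polygon_symmetry_group by rewrite cycle_subG mem_gen ?set21.
have or : n.+3 <= #[r].
  apply: dvdn_leq; first exact: order_gt0.
  have /(congr1 (fun s : {perm vertex} => s ord0 : nat)) := expg_order r.
  by rewrite rotationX perm1 /dvdn => ->.
have tNr : reflection n \notin <[r]>.
  apply/negP => /cycleP[k tE].
  have := congr1 (fun s : {perm vertex} => s ord0 : nat) tE.
  have := congr1 (fun s : {perm vertex} => s (ordS ord0) : nat) tE.
  rewrite !rotationX !permE !val_rev_ord val_ordS /= => t1 t0.
  (* Comparison at 0 forces k to be n+2 modulo n+3; such a rotation sends 1 to 0, but the reflection
     sends 1 to n+1. *)
  have : (k.+1 %% n.+3 = n.+3 %% n.+3)%N.
    by rewrite -addn1 -modnDml -[k]add0n -t0 subn0 addn1.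
  by rewrite -add1n -t1 modnn; lia.
have : <[r]> \proper polygon_symmetry_group.
  rewrite properE rG; apply: contra tNr => /fintype.subsetP; apply.
  by rewrite mem_gen ?set22.
move=> /proper_card; have := cardSg rG; move: or; rewrite /order.
move: #|<[r]>| #|polygon_symmetry_group| => m N m_ge /dvdnP[q ->].
by case: q => [|[|q]]; rewrite ?mul1n ?ltnn //; nia.
Qed.

(** The generators satisfy the dihedral relations, so the symmetry group is a quotient of the
    dihedral group; the lower bound on its order makes the quotient map an isomorphism. *)
Lemma dihedral_isog : [set: 'D_(2 * n + 6)] \isog polygon_symmetry_group.
Proof.
have -> : (2 * n + 6 = n.+3.*2)%N by lia.
rewrite isog_sym isogEcard card_dihedral// card_polygon_symmetry_group andbT.
rewrite Grp_dihedral//; apply/existsP; exists (rotation n, reflection n).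
rewrite /= !xpair_eqE rotationXn3 expgS expg1 reflectionK !eqxx /=.
rewrite joing_idl joing_idr eqxx /=.
by rewrite conjgE (canRL (mulgK _) (rotation_reflection n)) mulKg.
Qed.

End DihedralGroup.

(** * Passage between the face lattice and the non-crossing sets *)

Section FaceLattice.
Variables (R : realType) (n d : nat) (P : set 'rV[R]_d).
Variable phi : noncrossing_set n -> face_lattice P.
Hypothesis phiP : face_labelling phi.
Implicit Types (S T : noncrossing_set n) (F G : face_lattice P).
Implicit Types (s t : {perm 'I_n.+3}) (f g : order_aut (face_lattice P)).

Lemma le_face F G : (F <= G)%O = (F `<=` G)%classic :> Prop.
Proof. by rewrite -Order.le_val subsetEset. Qed.

Lemma le_empty_face F G : ~ (F !=set0)%classic -> (F <= G)%O.
Proof. by move=> F0; rewrite le_face => x Fx; case: F0; exists x. Qed.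

Lemma face_le_empty F G :
  (F <= G)%O -> ~ (G !=set0)%classic -> ~ (F !=set0)%classic.
Proof. by rewrite le_face => subFG G0 [x /subFG Gx]; case: G0; exists x. Qed.

Lemma face_labelling_inj : injective phi.
Proof.
move=> S T eq_phi; apply: val_inj; apply/eqP; rewrite finset.eqEsubset.
by rewrite -!phiP.1 eq_phi Order.POrderTheory.lexx.
Qed.

Lemma label_nonempty S : (phi S !=set0)%classic.
Proof. by apply/phiP.2; exists S. Qed.

Lemma order_aut_nonempty f F : (F !=set0)%classic -> (f F !=set0)%classic.
Proof.
have [_ f_mono] := order_autP f => F_ne; apply: contrapT => fF0.
(* If [f F] is empty, it lies below [f (f F)]; cancelling [f] puts [F] below the empty face
   [f F]. *)
have : (F <= f F)%O by rewrite -f_mono le_empty_face.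
by move=> /face_le_empty; apply.
Qed.

Lemma order_aut_empty f F : ~ (F !=set0)%classic -> f F = F.
Proof.
have [[f' fK f'K] f_mono] := order_autP f => F0.
have fF0 : ~ (f F !=set0)%classic.
  by apply: (face_le_empty _ F0); rewrite -{2}(f'K F) f_mono le_empty_face.
by apply/eqP; rewrite Order.POrderTheory.eq_le !le_empty_face.
Qed.

(** The permutation prescribes the values on the labelled faces, and the empty face is always
    fixed. *)
Lemma induced_by_uniq s f g : induced_by phi s f -> induced_by phi s g -> f = g.
Proof.
move=> sf sg; apply: val_inj; apply/funext => F /=.
have [/phiP.2[S <-]|F0] := pselect (F !=set0)%classic; last first.
  by rewrite !order_aut_empty.
have [[T TE ->] [U UE ->]] := (sf S, sg S).
by congr phi; apply: val_inj; rewrite [LHS]TE -UE.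
Qed.

Lemma induced_byM s t f g : induced_by phi s f -> induced_by phi t g ->
  induced_by phi (s * t)%g (g * f)%g.
Proof.
move=> sf tg S; have [T TE fT] := sf S; have [U UE gU] := tg T.
by exists U; [rewrite polygon_actM -TE | rewrite /= fT].
Qed.

Lemma induced_by_faithful s t f : 1 < n ->
  polygon_symmetry s -> polygon_symmetry t ->
  induced_by phi s f -> induced_by phi t f -> s = t.
Proof.
move=> n_gt1 sym_s sym_t sf tf; apply: polygon_act_faithful => // S.
have [[T <- ->] [U <-]] := (sf S, tf S).
by move/face_labelling_inj ->.
Qed.

Lemma order_aut_induced f : exists2 s, polygon_symmetry s & induced_by phi s f.
Proof.
have ex_h S : exists T, f (phi S) = phi T.
  have /phiP.2[T <-] := order_aut_nonempty f (label_nonempty S).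
  by exists T.
have [h hE] := choice ex_h.
have h_mono : {mono h : S T / (S : {set _}) \subset T}.
  by move=> S T; rewrite -!phiP.1 -!hE (order_autP f).2.
have [s sym_s hs] := noncrossing_set_aut h_mono.
by exists s => // S; exists (h S).
Qed.

(** The maps built from [s] and [s^-1] are monotone and mutually inverse, hence order
    automorphisms. *)
Lemma induced_order_aut s : polygon_symmetry s -> exists f, induced_by phi s f.
Proof.
have ex_act t : polygon_symmetry t ->
  exists u : face_lattice P -> face_lattice P,
    [/\ forall F, ~ (F !=set0)%classic -> u F = F,
        forall S T, T = polygon_act t S :> {set _} -> u (phi S) = phi T
      & {homo u : F G / (F <= G)%O}].
  move=> sym_t; pose act S := NoncrossingSet (polygon_act_noncrossing S sym_t).
  (* The empty face has no label and is sent to itself; on the other faces, injectivity of [phi]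
     makes the image well defined. *)
  have ex_image F : exists G, (~ (F !=set0)%classic -> G = F) /\
      (forall S, F = phi S -> G = phi (act S)).
    have [/phiP.2[S <-]|F0] := pselect (F !=set0)%classic; last first.
      by exists F; split=> // S FE; case: F0; rewrite FE; apply: label_nonempty.
    exists (phi (act S)); split; first by case; apply: label_nonempty.
    by move=> S' /face_labelling_inj <-.
  have [u uE] := choice ex_image.
  have u0 F : ~ (F !=set0)%classic -> u F = F by exact: (uE F).1.
  have u_act S : u (phi S) = phi (act S) by exact: (uE _).2.
  exists u; split=> // [S T TE|F G].
    by rewrite u_act; congr phi; apply: val_inj; rewrite [RHS]TE.
  have [/phiP.2[S <-]|F0 _] := pselect (F !=set0)%classic; last first.
    by rewrite u0//; apply: le_empty_face.
  have [/phiP.2[T <-]|G0] := pselect (G !=set0)%classic; last first.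
    by move/face_le_empty/(_ G0); case; apply: label_nonempty.
  by rewrite !u_act !phiP.1 => subTS; apply: imsetS.
have actK t u v : polygon_symmetry t ->
    (forall F, ~ (F !=set0)%classic -> u F = F) ->
    (forall F, ~ (F !=set0)%classic -> v F = F) ->
    (forall S T, T = polygon_act t S :> {set _} -> u (phi S) = phi T) ->
    (forall S T, T = polygon_act t^-1%g S :> {set _} -> v (phi S) = phi T) ->
    cancel u v.
  move=> sym_t u0 v0 uE vE F.
  have [/phiP.2[S <-]|F0] := pselect (F !=set0)%classic; last by rewrite u0 ?v0.
  rewrite (uE S (NoncrossingSet (polygon_act_noncrossing S sym_t)))//.
  by apply: vE; rewrite /= -polygon_actM mulgV polygon_act1.
move=> sym_s; have sym_sV := polygon_symmetryV sym_s.
have [u [u0 uE u_homo]] := ex_act s sym_s.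
have [v [v0 vE v_homo]] := ex_act _ sym_sV.
have uK : cancel u v by exact: (actK s).
have vK : cancel v u by apply: (actK s^-1%g); rewrite ?invgK.
have u_aut : `[< is_order_aut u >].
  apply/asboolP; split=> [|F G]; first by exists v.
  by apply/idP/idP => [/v_homo|/u_homo//]; rewrite !uK.
exists (OrderAut u_aut) => S.
exists (NoncrossingSet (polygon_act_noncrossing S sym_s)) => //.
exact: uE.
Qed.

End FaceLattice.

Theorem lemma2p2 (R : realType) (n d : nat) (P : set 'rV[R]_d)
    (hP : associahedron n P) :
  (forall phi : noncrossing_set n -> face_lattice P, face_labelling phi ->
     forall f : order_aut (face_lattice P),
       exists2 s : {perm 'I_n.+3}, polygon_symmetry s & induced_by phi s f) /\
  (2 <= n ->
     exists g : {multiplicative 'D_(2 * n + 6) -> order_aut (face_lattice P)},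
       bijective g).
Proof.
split=> [phi phiP f|n_gt1]; first exact: order_aut_induced.
have [_ _ _ [phi phiP]] := hP.
have /isogP[rho rho_inj rhoE] := dihedral_isog n.
have sym_rho x : polygon_symmetry (rho x).
  by apply/mem_polygon_symmetry_group; rewrite -rhoE mem_morphim ?inE.
(* Permutations compose left to right but order automorphisms right to left,
   hence the inverse. *)
have ex_g x := induced_order_aut phiP (polygon_symmetryV (sym_rho x)).
have [g gE] := choice ex_g.
have gM : {morph g : x y / (x * y)%g >-> (x * y)%g}.
  (* Inversion and [induced_byM] each reverse the order of the factors, so together they restore
     it. *)
  move=> x y; apply: (induced_by_uniq phiP (gE _)).
  by rewrite morphM ?inE// invMg; apply: induced_byM.
pose gm := HB.pack_for
  {multiplicative 'D_(2 * n + 6) -> order_aut (face_lattice P)} g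
  (isMultiplicative.Build _ _ g gM).
exists gm.
have g_inj : injective g.
  move=> x y eq_g; apply: (injmP rho_inj); rewrite ?inE//; apply: invg_inj.
  apply: (induced_by_faithful phiP n_gt1 _ _ (gE x)).
  - exact/polygon_symmetryV/sym_rho.
  - exact/polygon_symmetryV/sym_rho.
  - by rewrite eq_g; apply: gE.
have g_onto f : exists x, g x = f.
  have [s sym_s sf] := order_aut_induced phiP f.
  (* Since [g x] is induced by the inverse of [rho x], the element [x] must be sent by [rho] to
     [s^-1]. *)
  have : s^-1%g \in polygon_symmetry_group n.
    by apply/mem_polygon_symmetry_group/polygon_symmetryV.
  rewrite -rhoE => /morphimP[x _ _ sE]; exists x.
  apply: (induced_by_uniq phiP (gE x)).
  by rewrite -sE invgK.
have [g' g'K] := choice g_onto.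
by exists g' => // x; apply: g_inj; rewrite g'K.
Qed.
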